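(* Let $T$ be a densely defined operator with compact resolvent on a Hilbert space $H$. If there exists a sequence of bounded regions $(U_k)_{k\in\mathbb{N}}$ in $\mathbb{C}$ such that $\mathbb{C}=\bigcup_{k\in\mathbb{N}}U_k$, $\partial U_k\subset\varrho(T)$ for all $k$, and there is a constant $C\ge0$ with $$\|(T-z)^{-1}\|\le C\quad\text{for all } z\in\partial U_k,\ k\in\mathbb{N},$$ then the system of root subspaces of $T$ is complete.
   Context: Hilbert spaces are complex; operators are linear and possibly unbounded; $\varrho(T)$ is the resolvent set. For an eigenvalue $\lambda$ of $T$ the root subspace is $\mathcal{L}(\lambda)=\bigcup_{k\in\mathbb{N}}\ker(T-\lambda)^k$. A system of subspaces of $H$ is complete if the subspace it generates (finite linear combinations of vectors from its members) is dense in $H$. *)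

(* Defs.v *)
From HB Require Import structures.
From mathcomp Require Import all_boot all_order all_algebra sesquilinear complex.
From mathcomp Require Import all_classical all_reals all_analysis.

Set Implicit Arguments.
Unset Strict Implicit.
Unset Printing Implicit Defensive.

Import Order.TTheory GRing.Theory Num.Theory.
Import numFieldNormedType.Exports.

Local Open Scope classical_set_scope.
Local Open Scope complex_scope.
Local Open Scope ring_scope.

(* [R[i]] itself carries no topology in the library; its regular module
   [R[i]^o] is the complex plane with the norm topology. *)
Notation plane R := ((R : realType)[i]^o).

(* Over a complete normed space this says that [dot] is an inner product
   (linear on the left, conjugate-linear on the right, positive definite)
   inducing the norm, that is, that the space is a Hilbert space. *)
Definition hilbert_inner_product (R : realType)
    (H : completeNormedModType R[i]) (dot : {dot H for Num.conj}) :=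
  forall x : H, `|x| ^+ 2 = dot x x.

(* A possibly unbounded operator. The values of [op_fun] outside [op_dom] are
   meaningless, and no definition below depends on them. *)
Record operator (K : numFieldType) (H : normedModType K) := Operator {
  op_dom : set H ;
  op_fun :> H -> H ;
  op_dom0 : op_dom 0 ;
  op_dom_linear : forall (a : K) (x y : H),
    op_dom x -> op_dom y -> op_dom (a *: x + y) ;
  op_fun_linear : forall (a : K) (x y : H),
    op_dom x -> op_dom y -> op_fun (a *: x + y) = a *: op_fun x + op_fun y
}.

Section Everywhere_defined.
Variables (R : realType) (H : normedModType R[i]).
Implicit Type S : H -> H.

Definition bounded_operator S :=
  exists M : R[i], forall x : H, `|S x| <= M * `|x|.

Definition compact_operator S :=
  forall B : set H, bounded_set B -> precompact (S @` B).

(* Norms are elements of [R[i]] with zero imaginary part; [complex.Re] brings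
   them back to [R]. *)
Definition operator_norm S : R :=
  sup [set complex.Re `|S x| | x in [set x : H | `|x| <= 1]].

End Everywhere_defined.

Section Spectral_notions.
Variables (R : realType) (H : normedModType R[i]).
Implicit Types (T : operator H) (z : plane R).

Definition densely_defined T := dense (op_dom T).

Definition op_shift T z : H -> H := fun x => T x - z *: x.

(* [(T - z)^-1]; its value is significant when [T - z] maps the domain of [T]
   bijectively onto [H]. *)
Definition resolvent T z : H -> H := 'pinv_(fun=> 0) (op_dom T) (op_shift T z).

Definition resolvent_set T : set (plane R) :=
  [set z | set_bij (op_dom T) [set: H] (op_shift T z) /\
           bounded_operator (resolvent T z)].

Definition has_compact_resolvent T :=
  exists2 z, resolvent_set T z & compact_operator (resolvent T z).

Definition eigenvalue_of T z :=
  exists x, [/\ op_dom T x, x != 0 & T x = z *: x].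

(* Membership in the domain of [(T - z)^k] means that the iterates of index
   less than [k] all lie in the domain of [T]. *)
Definition ker_power T z (k : nat) : set H :=
  [set x | (forall i, (i < k)%N -> op_dom T (iter i (op_shift T z) x)) /\
           iter k (op_shift T z) x = 0].

Definition root_subspace T z : set H := \bigcup_k ker_power T z k.

Definition linear_span (A : set H) : set H :=
  [set v | exists n (a : 'I_n -> R[i]) (x : 'I_n -> H),
     (forall i, A (x i)) /\ v = \sum_(i < n) a i *: x i].

Definition complete_system (J : Type) (I : set J) (V : J -> set H) :=
  dense (linear_span (\bigcup_(j in I) V j)).

Definition root_subspaces_complete T :=
  complete_system (eigenvalue_of T) (root_subspace T).

End Spectral_notions.

Definition boundary (X : topologicalType) (A : set X) : set X :=
  closure A `\` A°.

Definition region (X : topologicalType) (U : set X) :=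
  [/\ U !=set0, open U & connected U].

(* Main.v *)
Require Import Defs.
From HB Require Import structures.
From mathcomp Require Import all_boot all_order all_algebra sesquilinear complex.
From mathcomp Require Import all_classical all_reals all_analysis.
From mathcomp Require Import ring lra.

Set Implicit Arguments.
Unset Strict Implicit.
Unset Printing Implicit Defensive.

Import Order.TTheory GRing.Theory Num.Theory.
Import numFieldNormedType.Exports.

Local Open Scope classical_set_scope.
Local Open Scope complex_scope.
Local Open Scope ring_scope.

(** Fix z0 in the resolvent set, let A = (T - z0)^-1, and let M be the closure of
    the span of the root subspaces. M is invariant under A, and P, the orthogonal
    projection with kernel M, satisfies P A = P A P. The claim is that M is
    everything, and the idea is that what remains of the resolvent modulo M,
    namely P (T - z)^-1, has no singularity left: it extends to an entire
    function of z, and the bounds on the boundaries of the U k make it bounded.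

    The extension. Put K = P A, a compact operator. For z in the resolvent set,
    f = P (T - z)^-1 y solves f - (z - z0) K f = K P y ([proj_resolvent]). This
    equation makes sense for every z, and it is uniquely solvable with a
    continuous inverse, because K has no nonzero eigenvalue: if P A x = mu x,
    then P x = x and (A - mu) x lies in M, which forces x into M and hence x = 0.
    The step from (A - mu) x to x is [shift_root_closure]. It uses the descent
    theorem of Riesz for the compact operator A on the closed invariant subspace
    M, together with the inclusion in M of the kernels of the powers of A - mu,
    which consist of root vectors of T at z0 + 1/mu ([ker_shift_root]). The same
    descent theorem, applied to K on the whole space, turns injectivity into
    bijectivity ([shift_fredholm]).

    The bound. The solution f(w), w = z - z0, is holomorphic in w, so the maximum
    principle on each U k gives |f(w)| <= C |y| on the whole plane. Liouville's
    theorem takes a direct form here: g(w) = (f(w) - f(0)) / w is the solution of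
    the same equation with right-hand side K K P y, hence also holomorphic, and
    it is O(1 / |w|), so the maximum principle on large discs gives g = 0. At
    w = 0 this reads K K P y = 0, that is P A A y = 0. The range of A A therefore
    lies in M, and it is dense because the domain of T is.

    The maximum principle rests on local expansions of third order. If F has
    an expansion F(p + h) = F(p) + h a + h^2 b + O(h^3), averaging over
    h = t, it, -t, -it shows that |F(p)| is at most the average of the |F(p + h)|
    up to O(t^3), whereas the average of |p + h|^2 exceeds |p|^2 by t^2. Hence
    |F(z)| + e |z|^2 has no local maximum for e > 0. For solutions of the above
    equation such expansions come from iterating the resolvent identity. *)

(** * Real-valued norms *)

Section Real_norm.
Variable R : realType.

(** The norm of a complex normed space takes values in [R[i]], whose order is
    partial; all estimates below are made on its real part. *)
Definition cnorm (a : R[i]) : R := complex.Re `|a|.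

Definition rnorm (V : normedModType R[i]) (x : V) : R := complex.Re `|x|.

Implicit Types V : normedModType R[i].

Lemma normE_cnorm (a : R[i]) : `|a| = (cnorm a)%:C.
Proof. by rewrite /cnorm RRe_real// normr_real. Qed.

Lemma cnormM (a b : R[i]) : cnorm (a * b) = cnorm a * cnorm b.
Proof. by apply: complexI; rewrite -normE_cnorm normrM rmorphM !normE_cnorm. Qed.

Lemma cnorm1 : cnorm 1 = 1.
Proof. by rewrite /cnorm normr1. Qed.

Lemma cnormN (a : R[i]) : cnorm (- a) = cnorm a.
Proof. by rewrite /cnorm normrN. Qed.

Lemma cnormX (a : R[i]) n : cnorm (a ^+ n) = cnorm a ^+ n.
Proof. by elim: n => [|n IH]; rewrite ?cnorm1// !exprS cnormM IH. Qed.

Lemma cnorm_ge0 (a : R[i]) : 0 <= cnorm a.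
Proof. by have := normr_ge0 a; rewrite normE_cnorm ler0c. Qed.

Lemma cnorm_gt0 (a : R[i]) : (0 < cnorm a) = (a != 0).
Proof. by rewrite -normr_gt0 normE_cnorm -(rmorph0 (real_complex R)) ltcR. Qed.

Lemma cnorm_real (a : R) : cnorm a%:C = `|a|.
Proof. by rewrite /cnorm normc_def /= expr0n /= addr0 sqrtr_sqr. Qed.

Lemma normE_rnorm V (x : V) : `|x| = (rnorm x)%:C.
Proof. by rewrite /rnorm RRe_real// normr_real. Qed.

Lemma rnorm_ge0 V (x : V) : 0 <= rnorm x.
Proof. by have := normr_ge0 x; rewrite normE_rnorm ler0c. Qed.

Lemma rnorm_eq0 V (x : V) : (rnorm x == 0) = (x == 0).
Proof.
by rewrite -(normr_eq0 x) normE_rnorm -(rmorph0 (real_complex R)) (inj_eq (@complexI _)).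
Qed.

Lemma rnorm0 V : rnorm (0 : V) = 0.
Proof. by apply/eqP; rewrite rnorm_eq0. Qed.

Lemma rnorm_gt0 V (x : V) : (0 < rnorm x) = (x != 0).
Proof. by rewrite lt_def rnorm_eq0 rnorm_ge0 andbT. Qed.

Lemma rnormD V (x y : V) : rnorm (x + y) <= rnorm x + rnorm y.
Proof.
by have := ler_normD x y; rewrite !normE_rnorm -rmorphD lecR.
Qed.

Lemma rnormN V (x : V) : rnorm (- x) = rnorm x.
Proof. by rewrite /rnorm normrN. Qed.

Lemma rdistC V (x y : V) : rnorm (x - y) = rnorm (y - x).
Proof. by rewrite -rnormN opprB. Qed.

Lemma rdist_triangle V (y x z : V) : rnorm (x - z) <= rnorm (x - y) + rnorm (y - z).
Proof. by have := rnormD (x - y) (y - z); rewrite addrA subrK. Qed.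

Lemma rnorm_distl V (x y : V) : rnorm x - rnorm y <= rnorm (x - y).
Proof. by have := rnormD (x - y) y; rewrite subrK lerBlDr. Qed.

Lemma rnormZ V (a : R[i]) (x : V) : rnorm (a *: x) = cnorm a * rnorm x.
Proof.
by rewrite {1}/rnorm normrZ !normE_rnorm normE_cnorm -rmorphM.
Qed.

Lemma rnorm_small V (x : V) : (forall e : R, 0 < e -> rnorm x < e) -> x = 0.
Proof.
move=> h; apply/eqP; apply: contraT; rewrite -rnorm_gt0 => /h.
by rewrite ltxx.
Qed.

Lemma posC_real (e : R[i]) : 0 < e -> exists2 d : R, 0 < d & e = d%:C.
Proof.
move=> e0; have er : e \is Num.real by rewrite realE ltW.
by exists (complex.Re e); rewrite ?RRe_real// -ltcR RRe_real.
Qed.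

Lemma rnorm_ball V (x y : V) (e : R) : ball x e%:C y <-> rnorm (x - y) < e.
Proof. by rewrite -ball_normE /ball_ /= normE_rnorm ltcR. Qed.

Lemma rnorm_nbhs V (x : V) (A : set V) :
  nbhs x A <-> exists2 e : R, 0 < e & forall y, rnorm (x - y) < e -> A y.
Proof.
split=> [/nbhs_ballP[e /= /posC_real[d d0 ->] h]|[e e0 h]].
  by exists d => // y xy; apply: h; apply/rnorm_ball.
apply/nbhs_ballP; exists e%:C => /=; first by rewrite -(rmorph0 (real_complex R)) ltcR.
by move=> y /rnorm_ball; exact: h.
Qed.

Lemma rnorm_closure V (A : set V) (x : V) :
  closure A x <-> forall e : R, 0 < e -> exists2 y, A y & rnorm (x - y) < e.
Proof.
split=> [h e e0|h B /rnorm_nbhs[e e0 hB]].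
  have [|y [Ay Sy]] := h [set y | rnorm (x - y) < e]; last by exists y.
  by apply/rnorm_nbhs; exists e.
by have [y Ay /hB By] := h _ e0; exists y.
Qed.

Lemma rnorm_closed V (A : set V) : closed A ->
  forall x, (forall e : R, 0 < e -> exists2 y, A y & rnorm (x - y) < e) -> A x.
Proof. by move=> cA x /rnorm_closure /cA. Qed.

Lemma rnorm_dense V (A : set V) : dense A <-> forall x, closure A x.
Proof.
split=> [dA x B|cA O [x Ox] oO].
  rewrite nbhsE => -[W [oW Wx] WB].
  have [|y [Wy Ay]] := dA W _ oW; first by exists x.
  by exists y; split=> //; exact: WB.
have [y [Ay Oy]] := cA x O (open_nbhs_nbhs (conj oO Ox)).
by exists y.
Qed.

Lemma rnorm_bounded_set V (A : set V) :
  bounded_set A <-> exists M : R, forall x, A x -> rnorm x <= M.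
Proof.
split=> [/ex_strict_bound_gt0[M M0 hM]|[M hM]].
  by exists (complex.Re M) => x /hM /=; rewrite ltcE => /andP[_ /ltW].
exists M%:C; split; first by apply/complex_realP; exists M.
move=> x Mx y /hM /=; rewrite normE_rnorm -lecR => /le_trans; apply.
exact: ltW.
Qed.

End Real_norm.

(** * Orthogonal projections *)

Lemma natSinv_small (R : realType) (e : R) : 0 < e ->
  exists N, forall n, (N <= n)%N -> n.+1%:R^-1 < e.
Proof.
move=> e0; have [N _ hN] := near_infty_natSinv_lt (PosNum e0).
by exists N => n /hN.
Qed.

Definition subspace (R : realType) (H : normedModType R[i]) (V : set H) :=
  V 0 /\ forall (a : R[i]) x y, V x -> V y -> V (a *: x + y).

Section Subspace.
Variables (R : realType) (H : normedModType R[i]) (V : set H).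
Hypothesis sV : subspace V.

Lemma subspace0 : V 0. Proof. by case: sV. Qed.

Lemma subspaceZ (a : R[i]) x : V x -> V (a *: x).
Proof. by case: sV => V0 h Vx; have := h a _ _ Vx V0; rewrite addr0. Qed.

Lemma subspaceD x y : V x -> V y -> V (x + y).
Proof. by case: sV => _ h Vx Vy; have := h 1 _ _ Vx Vy; rewrite scale1r. Qed.

Lemma subspaceN x : V x -> V (- x).
Proof. by move=> Vx; rewrite -scaleN1r; exact: subspaceZ. Qed.

Lemma subspaceB x y : V x -> V y -> V (x - y).
Proof. by move=> Vx Vy; apply: subspaceD => //; exact: subspaceN. Qed.

End Subspace.

Lemma bundle_linear (R : realType) (H : normedModType R[i]) (f : H -> H) :
  linear f -> exists g : {linear H -> H}, (g : H -> H) = f.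
Proof.
move=> lf.
pose g : {linear H -> H} := HB.pack f (GRing.isLinear.Build _ _ _ _ f lf).
by exists g.
Qed.

Definition cauchy_sequences_converge (R : realType) (H : normedModType R[i]) :=
  forall u : nat -> H,
    (forall e : R, 0 < e -> exists N, forall m n,
       (N <= m)%N -> (N <= n)%N -> rnorm (u m - u n) < e) ->
    exists l, forall e : R, 0 < e ->
      exists N, forall n, (N <= n)%N -> rnorm (l - u n) < e.

Lemma complete_cauchy_sequences (R : realType) (H : completeNormedModType R[i]) :
  cauchy_sequences_converge H.
Proof.
move=> u cu.
have : cvg (u @ \oo).
  apply/cauchy_cvgP/cauchy_exP => e /= /posC_real[d d0 ->].
  have [N hN] := cu _ d0; exists (u N).
  by exists N => // n /= Nn; apply/rnorm_ball; exact: hN.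
case/cvg_ex => [l ul]; exists l => e e0.
have /ul [N _ hN] : nbhs l [set y | rnorm (l - y) < e].
  by apply/rnorm_nbhs; exists e.
by exists N => n /hN.
Qed.

Section Projection.
Variables (R : realType) (H : normedModType R[i]).
Variable (dot : {dot H for Num.conj}).
Hypothesis normE_dot : forall x : H, `|x| ^+ 2 = dot x x.
Hypothesis complete : cauchy_sequences_converge H.

Lemma rnorm_dot (x : H) : (rnorm x ^+ 2)%:C = dot x x.
Proof. by rewrite -normE_dot normE_rnorm rmorphXn. Qed.

Lemma parallelogram (x y : H) :
  rnorm (x + y) ^+ 2 + rnorm (x - y) ^+ 2 = 2 * (rnorm x ^+ 2 + rnorm y ^+ 2).
Proof.
rewrite mulr_natl mulr2n; apply: complexI; rewrite !rmorphD /= !rnorm_dot.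
by rewrite dnormD dnormB addrACA subrr addr0.
Qed.

Lemma rnormB_sqr (x y : H) :
  rnorm (x - y) ^+ 2 = rnorm x ^+ 2 + rnorm y ^+ 2 - 2 * complex.Re (dot x y).
Proof.
rewrite mulr_natl; apply: complexI; rewrite rmorphB rmorphMn rmorphD /= !rnorm_dot.
by rewrite dnormB addcJ mulr_natl.
Qed.

Lemma pythagoras (x y : H) : dot x y = 0 ->
  rnorm (x + y) ^+ 2 = rnorm x ^+ 2 + rnorm y ^+ 2.
Proof.
move=> xy; apply: complexI; rewrite rmorphD /= !rnorm_dot dnormD xy.
by rewrite rmorph0 !addr0.
Qed.

Variable V : set H.
Hypotheses (sV : subspace V) (cV : closed V).

(** A minimising sequence is Cauchy, since by the parallelogram law two points of
    [V] nearly closest to [x] have a midpoint that would be closer still if they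
    were far apart. *)
Lemma best_approximation (x : H) :
  exists2 v, V v & forall w, V w -> rnorm (x - v) <= rnorm (x - w).
Proof.
pose A := [set rnorm (x - w) ^+ 2 | w in V]; pose D := inf A.
have lbA : has_inf A.
  split; first by exists (rnorm (x - 0) ^+ 2), 0 => //; exact: subspace0.
  by exists 0 => _ [w _ <-]; exact: sqr_ge0.
have leD w : V w -> D <= rnorm (x - w) ^+ 2.
  by move=> Vw; apply: ge_inf; [case: lbA | exists w].
pose h n : R := n.+1%:R^-1.
have /choice[v hv] : forall n, exists w,
    V w /\ rnorm (x - w) ^+ 2 < D + h n.
  move=> n; have [|_ [w Vw <-] ?] := @inf_adherent R A (h n) _ lbA.
    by rewrite invr_gt0.
  by exists w.
have close m n : rnorm (v m - v n) ^+ 2 <= 2 * (h m + h n).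
  have [Vm hm] := hv m; have [Vn hn] := hv n.
  pose mid : H := 2^-1 *: (v m + v n).
  have Vmid : V mid by apply: subspaceZ => //; exact: subspaceD.
  have := parallelogram (x - v m) (x - v n).
  have -> : x - v m - (x - v n) = v n - v m.
    by rewrite opprB addrC addrA subrK.
  have -> : x - v m + (x - v n) = 2 *: (x - mid).
    rewrite scalerBr scalerA divff ?pnatr_eq0// scale1r scaler_nat mulr2n.
    by rewrite addrACA opprD.
  have := leD _ Vmid.
  rewrite rnormZ (_ : cnorm 2 = 2); last first.
    by rewrite -(rmorph_nat (real_complex R) 2) cnorm_real normr_nat.
  rewrite exprMn (rdistC (v n)); lra.
have cauchy e : 0 < e -> exists N, forall m n,
    (N <= m)%N -> (N <= n)%N -> rnorm (v m - v n) < e.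
  move=> e0; have [|N] := @natSinv_small _ (e ^+ 2 / 4).
    by rewrite divr_gt0 ?exprn_gt0.
  move=> hN; exists N => m n Nm Nn.
  rewrite -(@ltr_pXn2r _ 2) ?nnegrE ?rnorm_ge0 ?(ltW e0)//.
  have hm : h m < e ^+ 2 / 4 := hN _ Nm; have hn : h n < e ^+ 2 / 4 := hN _ Nn.
  have := close m n; lra.
have [l hl] := complete cauchy.
have Vl : V l.
  apply: (rnorm_closed cV) => e /hl[N hN]; exists (v N); last exact: hN.
  by have [] := hv N.
exists l => // w Vw; rewrite leNgt; apply/negP => lt_wl.
have w0 := rnorm_ge0 (x - w); set s := rnorm (x - w) in lt_wl w0.
have e0 : 0 < (rnorm (x - l) - s) / 2 by lra.
have d0 : 0 < ((rnorm (x - l) + s) / 2) ^+ 2 - s ^+ 2.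
  by rewrite subr_gt0 ltr_pXn2r ?nnegrE//; lra.
have [N1 h1] := hl _ e0; have [N2 h2] := natSinv_small d0.
have := h1 _ (leq_maxl N1 N2); have := h2 _ (leq_maxr N1 N2).
set n := maxn N1 N2; rewrite -/(h n) => hn2 hn1.
have [_ hn] := hv n; have := leD _ Vw; rewrite -/s => leDs.
have := rdist_triangle (v n) x l; rewrite (rdistC (v n)) => tri.
have : ((rnorm (x - l) + s) / 2) ^+ 2 < rnorm (x - v n) ^+ 2.
  by rewrite ltr_pXn2r ?nnegrE ?rnorm_ge0//; lra.
lra.
Qed.

(** If [c], the inner product of [x - v] and [w], were nonzero, moving from [v]
    by a small positive multiple of [c *: w] would decrease the distance to [x]. *)
Lemma best_approximation_orthogonal (x v : H) : V v ->
  (forall w, V w -> rnorm (x - v) <= rnorm (x - w)) ->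
  forall w, V w -> dot (x - v) w = 0.
Proof.
move=> Vv vmin w Vw; set e := x - v; set c := dot e w.
have main s : 2 * s * cnorm c ^+ 2 <= s ^+ 2 * cnorm c ^+ 2 * rnorm w ^+ 2.
  have Vu : V (v + (s%:C * c) *: w) by apply: subspaceD => //; exact: subspaceZ.
  have := vmin _ Vu; rewrite opprD addrA -/e -(@ler_pXn2r _ 2) ?nnegrE ?rnorm_ge0//.
  rewrite (rnormB_sqr e) rnormZ cnormM cnorm_real linearZr_LR /= -/c rmorphM /=.
  have -> : (s%:C)^*%R = s%:C by rewrite conj_Creal//; apply/complex_realP; exists s.
  rewrite -[_ * _^*%R * c]mulrA [_^*%R * c]mulrC -normCK normE_cnorm -rmorphXn.
  rewrite -rmorphM /= !exprMn real_normK ?num_real//; lra.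
(* The factor [1 / (|w|^2 + 1)] is small enough for the quadratic term to lose,
   and it is defined even when [w = 0]. *)
have := main (rnorm w ^+ 2 + 1)^-1.
have w1 : 0 < rnorm w ^+ 2 + 1 by rewrite ltr_wpDl// sqr_ge0.
set s := (_)^-1 => hs.
have s0 : 0 < s by rewrite invr_gt0.
have sw : s * rnorm w ^+ 2 = 1 - s.
  by rewrite -[in RHS](mulVf (lt0r_neq0 w1)) -/s mulrDr mulr1 addrK.
apply/eqP; apply: contraT; rewrite -cnorm_gt0 => c0.
have : 0 < s * cnorm c ^+ 2 by rewrite mulr_gt0 ?exprn_gt0.
have : 0 <= s ^+ 2 * cnorm c ^+ 2 by rewrite mulr_ge0 ?sqr_ge0.
have : s ^+ 2 * cnorm c ^+ 2 * rnorm w ^+ 2 =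
       s * cnorm c ^+ 2 - s ^+ 2 * cnorm c ^+ 2.
  by rewrite -[rnorm w ^+ 2](mulKf (lt0r_neq0 s0)) sw; field; exact: lt0r_neq0.
lra.
Qed.

Definition orthogonal_to (z : H) := forall w, V w -> dot z w = 0.

Lemma orthogonal_unique z z' :
  orthogonal_to z -> orthogonal_to z' -> V (z - z') -> z = z'.
Proof.
move=> oz oz' Vd; apply/eqP; rewrite -subr_eq0 -(dnorm_eq0 dot).
by rewrite linearBl /= oz// oz'// subrr.
Qed.

End Projection.

(** The inner product enters what follows only through these maps, the orthogonal
    projections with kernel [V]. *)
Definition closed_subspaces_split (R : realType) (H : normedModType R[i]) :=
  forall V : set H, subspace V -> closed V ->
  exists P : {linear H -> H},
    [/\ forall x, rnorm (P x) <= rnorm x,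
        forall x, V x <-> P x = 0 &
        forall x, V (x - P x)].

Lemma orthogonal_projection (R : realType) (H : normedModType R[i])
    (dot : {dot H for Num.conj}) :
  (forall x : H, `|x| ^+ 2 = dot x x) -> cauchy_sequences_converge H ->
  closed_subspaces_split H.
Proof.
move=> normE_dot complete V sV cV.
have /choice[P hP] : forall x, exists z, V (x - z) /\ orthogonal_to dot V z.
  move=> x; have [v Vv vmin] := best_approximation normE_dot complete sV cV x.
  exists (x - v); rewrite subKr; split=> //.
  exact: (best_approximation_orthogonal normE_dot sV Vv vmin).
have uniq x z : V (x - z) -> orthogonal_to dot V z -> P x = z.
  move=> Vz oz; have [VP oP] := hP x.
  apply: (orthogonal_unique oP oz).
  by have := subspaceB sV Vz VP; rewrite opprB addrC addrA subrK.
have P_linear : linear P.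
  move=> a x y; have [Vx ox] := hP x; have [Vy oy] := hP y.
  apply: uniq; last by move=> w Vw; rewrite linearPl /= ox// oy// mulr0 addr0.
  rewrite opprD addrACA -scalerBr.
  by apply: subspaceD => //; exact: subspaceZ.
have [Q QP] := bundle_linear P_linear; exists Q; rewrite QP.
split=> [x|x|x]; last by have [] := hP x.
- have [Vx ox] := hP x; rewrite -(@ler_pXn2r _ 2) ?nnegrE ?rnorm_ge0//.
  rewrite -{2}(subrK (P x) x) addrC (pythagoras normE_dot (ox _ Vx)).
  by rewrite lerDl sqr_ge0.
- split=> [Vx|Px0]; last by have [] := hP x; rewrite Px0 subr0.
  by apply: uniq; rewrite ?subr0// => w _; rewrite linear0l.
Qed.

(** * Riesz theory of compact operators *)

Definition spectral_shift (R : realType) (H : normedModType R[i])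
    (K : {linear H -> H}) (mu : R[i]) : H -> H := fun x => K x - mu *: x.

Section Spectral_shift.
Variables (R : realType) (H : normedModType R[i]).
Variables (K : {linear H -> H}) (mu : R[i]).

Lemma spectral_shift_is_linear : linear (spectral_shift K mu).
Proof.
move=> a x y; rewrite /spectral_shift linearP !scalerDr scalerA mulrC -scalerA.
by rewrite scalerN opprD addrACA.
Qed.

HB.instance Definition _ := GRing.isLinear.Build _ _ _ _ (spectral_shift K mu)
  spectral_shift_is_linear.

End Spectral_shift.

(** Compactness through cluster values: [k] is fixed once, and arbitrarily late
    terms of the sequence have images near it, as when passing to a
    subsequence. *)
Definition seq_compact_operator (R : realType) (H : normedModType R[i])
    (K : H -> H) :=
  forall u : nat -> H, (forall n, rnorm (u n) <= 1) ->
  exists k, forall e : R, 0 < e -> forall N,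
    exists2 n, (N <= n)%N & rnorm (K (u n) - k) < e.

Lemma compact_operator_seq (R : realType) (H : normedModType R[i]) (K : H -> H) :
  compact_operator K -> seq_compact_operator K.
Proof.
move=> cK u u1.
have [|U KU [cU _]] := cK [set x | rnorm x <= 1].
  by apply/rnorm_bounded_set; exists 1.
have FU : ((K \o u) @ \oo) U.
  by exists 0%N => // n _ /=; apply: KU; exists (u n) => //=; exact: u1.
have [k [_ hk]] := cU _ _ FU.
exists k => e e0 N.
have [] := hk ((K \o u) @` [set n | (N <= n)%N]) [set y | rnorm (k - y) < e].
- by exists N => // n /= Nn; exists n.
- by apply/rnorm_nbhs; exists e.
by move=> _ [[n /= Nn <-] /= kn]; exists n => //; rewrite rdistC.
Qed.

Definition rbounded (R : realType) (H : normedModType R[i]) (S : H -> H) :=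
  exists2 M : R, 0 <= M & forall x, rnorm (S x) <= M * rnorm x.

Lemma bounded_operator_rbounded (R : realType) (H : normedModType R[i])
  (S : H -> H) : bounded_operator S -> rbounded S.
Proof.
move=> [[a b] hM]; exists `|a| => // x.
have := hM x; rewrite !normE_rnorm lecE => /andP[_] /=.
rewrite mulr0 subr0 => /le_trans; apply.
by rewrite ler_wpM2r ?rnorm_ge0 ?ler_norm.
Qed.

Lemma rbounded_comp (R : realType) (H : normedModType R[i]) (S S' : H -> H) :
  rbounded S -> rbounded S' -> rbounded (S \o S').
Proof.
move=> [M M0 hM] [N N0 hN]; exists (M * N); first exact: mulr_ge0.
by move=> x /=; rewrite (le_trans (hM _))// -mulrA ler_wpM2l.
Qed.

Lemma rbounded_shift (R : realType) (H : normedModType R[i])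
  (K : {linear H -> H}) mu : rbounded K -> rbounded (spectral_shift K mu).
Proof.
move=> [M M0 hM]; exists (M + cnorm mu); first by rewrite addr_ge0 ?cnorm_ge0.
move=> x; rewrite (le_trans (rnormD _ _))// rnormN rnormZ mulrDl.
by rewrite lerD2r hM.
Qed.

Lemma rbounded_small (R : realType) (H : normedModType R[i]) (S : H -> H) (e : R) :
  rbounded S -> 0 < e ->
  exists2 d : R, 0 < d & forall x, rnorm x < d -> rnorm (S x) < e.
Proof.
move=> [M M0 hM] e0; have M1 : 0 < M + 1 by rewrite ltr_wpDl.
exists (e / (M + 1)); first by rewrite divr_gt0.
move=> x; rewrite ltr_pdivlMr// => xe; apply: le_lt_trans (hM x) _.
by apply: le_lt_trans xe; rewrite mulrC ler_wpM2l ?rnorm_ge0 ?lerDl.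
Qed.

(** The form of continuity by which kernels and preimages are seen to be closed:
    the approximants may be restricted to a set [V] on which [S] is understood. *)
Lemma rbounded_limit (R : realType) (H : normedModType R[i]) (S : {linear H -> H})
    (V : set H) (x y : H) :
  rbounded S ->
  (forall e : R, 0 < e -> exists v, [/\ V v, rnorm (x - v) < e & rnorm (y - S v) < e]) ->
  S x = y.
Proof.
move=> bS h; apply/eqP; rewrite -subr_eq0; apply/eqP/rnorm_small => e e0.
have e20 : 0 < e / 2 by rewrite divr_gt0.
have [d d0 hd] := rbounded_small bS e20.
have m0 : 0 < Num.min d (e / 2) by rewrite lt_min d0.
have [v [_]] := h _ m0; rewrite !lt_min => /andP[/hd xv _] /andP[_ yv].
have := rdist_triangle (S v) (S x) y; rewrite -linearB (rdistC (S v)).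
lra.
Qed.

(** The distance one is attained by a unit vector orthogonal to [V]; orthogonality
    is expressed by the projection [P], which kills [V] and does not increase
    norms. *)
Lemma riesz_lemma (R : realType) (H : normedModType R[i]) (V W : set H) (x : H) :
  closed_subspaces_split H -> subspace V -> closed V -> subspace W ->
  V `<=` W -> W x -> ~ V x ->
  exists y, [/\ W y, rnorm y = 1 & forall v, V v -> 1 <= rnorm (y - v)].
Proof.
move=> splits sV cV sW VW Wx nVx; have [P [P1 P0 PV]] := splits V sV cV.
have Px0 : P x != 0 by apply/eqP => /P0.
have PP : P (P x) = P x.
  have /P0 := PV x; rewrite linearB => /eqP; by rewrite subr_eq0 => /eqP.
pose a := (rnorm (P x))^-1%:C.
have y1 : rnorm (a *: P x) = 1.
  rewrite rnormZ cnorm_real ger0_norm ?invr_ge0 ?rnorm_ge0// mulVf//.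
  by rewrite rnorm_eq0.
exists (a *: P x); split=> // [|v /P0 Pv0].
  apply: subspaceZ => //; rewrite -[P x](subKr x); apply: subspaceB => //.
  exact: VW.
have := P1 (a *: P x - v); rewrite linearB linearZ /= PP Pv0 subr0.
by rewrite y1.
Qed.

Section Riesz_theory.
Variables (R : realType) (H : normedModType R[i]).
Hypothesis complete : cauchy_sequences_converge H.
Hypothesis splits : closed_subspaces_split H.
Variables (K : {linear H -> H}) (mu : R[i]).
Hypotheses (cK : seq_compact_operator K) (bK : rbounded K) (mu0 : mu != 0).

Local Notation S := (spectral_shift K mu).

Let bS : rbounded S. Proof. exact: rbounded_shift. Qed.

(** Otherwise some unit vectors [u n] satisfy [S (u n) -> 0]; compactness of [K]
    makes [mu *: u n = K (u n) - S (u n)] cluster, and the cluster point is a unit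
    vector in the kernel of [S]. *)
Lemma shift_bounded_below (V : set H) : subspace V -> closed V ->
  (forall x, V x -> S x = 0 -> x = 0) ->
  exists2 c : R, 0 < c & forall x, V x -> rnorm x <= c * rnorm (S x).
Proof.
move=> sV cV inj; apply: contrapT => nbelow.
have /choice[u hu] : forall n, exists x,
    [/\ V x, rnorm x = 1 & rnorm (S x) < n.+1%:R^-1].
  move=> n; apply: contrapT => nx; apply: nbelow; exists n.+1%:R => // x Vx.
  rewrite leNgt; apply/negP => xS; apply: nx.
  have x0 : 0 < rnorm x by apply: le_lt_trans xS; rewrite mulr_ge0 ?rnorm_ge0.
  pose a := (rnorm x)^-1%:C.
  have aE : cnorm a = (rnorm x)^-1.
    by rewrite cnorm_real ger0_norm// invr_ge0 ltW.
  exists (a *: x); split; first exact: subspaceZ.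
    by rewrite rnormZ aE mulVf ?gt_eqF.
  by rewrite linearZ /= rnormZ aE ltr_pdivrMl// mulrC ltr_pdivlMl.
have [|k hk] := cK (u := u); first by move=> n; have [_ ->] := hu n.
have mu_gt0 : 0 < cnorm mu by rewrite cnorm_gt0.
(* [k / mu] is a cluster point of the unit vectors [u n]. *)
have near_u e : 0 < e ->
    exists n, rnorm (mu^-1 *: k - u n) < e /\ rnorm (S (u n)) < e.
  move=> e0; have d0 : 0 < Num.min e (cnorm mu * e / 2).
    by rewrite lt_min e0 divr_gt0 ?mulr_gt0.
  have [N hN] := natSinv_small d0.
  have d0' : 0 < cnorm mu * e / 2 by rewrite divr_gt0 ?mulr_gt0.
  have [n /hN nN kn] := hk _ d0' N.
  have [_ _ Sn] := hu n; have := lt_trans Sn nN; rewrite lt_min => /andP[Se Smu].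
  exists n; split=> //; rewrite -(ltr_pM2l mu_gt0) -rnormZ scalerBr scalerA.
  rewrite mulfV// scale1r rdistC.
  have -> : mu *: u n - k = (K (u n) - k) - S (u n).
    by rewrite /spectral_shift opprB [RHS]addrC addrA subrK.
  apply: le_lt_trans (rnormD _ _) _; rewrite rnormN.
  by move: kn Smu; set a := rnorm _; set b := rnorm _; lra.
set x := mu^-1 *: k in near_u.
have Vx : V x.
  apply: (rnorm_closed cV) => e /near_u[n [xn _]].
  by exists (u n) => //; have [] := hu n.
have Sx : S x = 0.
  apply: (@rbounded_limit _ _ _ V) => // e /near_u[n [xn Sn]].
  by exists (u n); rewrite sub0r rnormN; have [] := hu n.
have half : (0 : R) < 1 / 2 by lra.
have [n [xn _]] := near_u _ half; have [_ un _] := hu n.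
move: xn; rewrite (inj _ Vx Sx) sub0r rnormN un; lra.
Qed.

(** Projecting off the kernel [W] of [S] in [V] does not change the values of [S],
    and on the remaining part [V'] of [V] the operator is bounded below. *)
Lemma shift_closed_image (V : set H) : subspace V -> closed V -> closed (S @` V).
Proof.
move=> sV cV.
pose W := V `&` [set x | S x = 0].
have sW : subspace W.
  split=> [|a x y [Vx Sx] [Vy Sy]]; first by split; [exact: subspace0|exact: linear0].
  split; first by case: sV => _; exact.
  by rewrite /= linearP /= Sx Sy scaler0 addr0.
have cW : closed W.
  move=> x /rnorm_closure Wx; split.
    by apply: (rnorm_closed cV) => e /Wx[y [Vy _] xy]; exists y.
  apply: (@rbounded_limit _ _ _ W) => // e /Wx[y [Vy Sy] xy].
  by exists y; rewrite /= Sy subrr rnorm0; split=> //; apply: le_lt_trans xy; exact: rnorm_ge0.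
have [P [P1 P0 PW]] := splits sW cW.
pose V' := V `&` [set x | P x = x].
have bP : rbounded P by exists 1 => // x; rewrite mul1r.
have sV' : subspace V'.
  split=> [|a x y [Vx Px] [Vy Py]]; first by split; [exact: subspace0|exact: linear0].
  split; first by case: sV => _; exact.
  by rewrite /= linearP Px Py.
have cV' : closed V'.
  move=> x /rnorm_closure V'x; split.
    by apply: (rnorm_closed cV) => e /V'x[y [Vy _] xy]; exists y.
  by apply: (@rbounded_limit _ _ _ V') => // e /V'x[y [Vy Py] xy]; exists y; rewrite /= Py.
have [c c0 hc] : exists2 c : R, 0 < c & forall x, V' x -> rnorm x <= c * rnorm (S x).
  by apply: shift_bounded_below => // x [Vx Px] Sx; rewrite -Px; apply/P0.
have PV' v : V v -> V' (P v) /\ S (P v) = S v.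
  move=> Vv; have [VPv SPv] := PW v; split; last first.
    by apply/esym/eqP; rewrite -subr_eq0 -linearB; apply/eqP.
  split; first by rewrite -[P v](subKr v); exact: subspaceB.
  by have /P0 := PW v; rewrite linearB => /eqP; rewrite subr_eq0 => /eqP.
move=> y /rnorm_closure yS.
pose h n : R := n.+1%:R^-1.
have /choice[u hu] : forall n, exists x, V' x /\ rnorm (y - S x) < h n.
  move=> n; have [|_ [v Vv <-] yv] := yS (h n); first by rewrite invr_gt0.
  by have [V'v Sv] := PV' v Vv; exists (P v); rewrite Sv.
have [e e0|l hl] := complete (u := u).
  have [|N hN] := @natSinv_small _ (e / c / 2); first by rewrite !divr_gt0.
  exists N => m n Nm Nn; have [Vm ym] := hu m; have [Vn yn] := hu n.
  apply: le_lt_trans (hc _ (subspaceB sV' Vm Vn)) _.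
  rewrite linearB /= mulrC -ltr_pdivlMr//.
  have hm : h m < e / c / 2 := hN _ Nm; have hn : h n < e / c / 2 := hN _ Nn.
  have := rdist_triangle y (S (u m)) (S (u n)); rewrite (rdistC _ y); lra.
exists l.
  apply: (rnorm_closed cV) => e /hl[N hN]; exists (u N); last exact: hN.
  by have [[]] := hu N.
apply: (@rbounded_limit _ _ _ V) => // e e0.
have [N1 h1] := hl _ e0; have [N2 h2] := natSinv_small e0.
have := h1 _ (leq_maxl N1 N2); have := h2 _ (leq_maxr N1 N2).
set n := maxn _ _ => hn un; have [[Vn _] yn] := hu n.
by exists (u n); split=> //; apply: lt_trans yn _.
Qed.

Lemma shift_iter_linear n a x y :
  iter n S (a *: x + y) = a *: iter n S x + iter n S y.
Proof. by elim: n => //= n ->; rewrite linearP. Qed.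

(** Riesz's descent theorem: if the images [S^m V] kept decreasing, unit vectors
    [y m] of [S^m V] at distance one from [S^(m+1) V] would have images under [K]
    at distance at least [|mu|] from one another. *)
Lemma shift_finite_descent (V : set H) : subspace V -> closed V ->
  (forall x, V x -> V (S x)) ->
  exists m, iter m S @` V `<=` iter m.+1 S @` V.
Proof.
move=> sV cV SV; pose Y m := iter m S @` V.
have YS m : Y m.+1 = S @` Y m.
  by rewrite /Y image_comp.
have sY m : subspace (Y m).
  split; first by exists 0; [exact: subspace0|elim: m => //= m ->; exact: linear0].
  move=> a _ _ [x Vx <-] [y Vy <-]; exists (a *: x + y).
    by case: sV => _; exact.
  exact: shift_iter_linear.
have cY m : closed (Y m).
  elim: m => [|m IH]; first by rewrite /Y /= image_id.
  by rewrite YS; exact: shift_closed_image.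
have decr m : Y m.+1 `<=` Y m.
  by move=> _ [x Vx <-]; exists (S x); rewrite -?iterSr//; exact: SV.
have decrn m n : (m <= n)%N -> Y n `<=` Y m.
  by move=> /subnK <-; elim: (n - m)%N => // p IH x /decr /IH.
apply: contrapT => nstable.
have /choice[y hy] : forall m, exists y,
    [/\ Y m y, rnorm y = 1 & forall v, Y m.+1 v -> 1 <= rnorm (y - v)].
  move=> m; have [x Yx nYx] : exists2 x, Y m x & ~ Y m.+1 x.
    apply: contrapT => nx; apply: nstable; exists m => x Yx.
    by apply: contrapT => nYx; apply: nx; exists x.
  exact: (riesz_lemma splits (sY _) (cY _) (sY _) (decr m) Yx nYx).
have mu_gt0 : 0 < cnorm mu by rewrite cnorm_gt0.
have [|k hk] := cK (u := y); first by move=> n; have [_ ->] := hy n.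
have mu2 : 0 < cnorm mu / 2 by rewrite divr_gt0.
have [m _ km] := hk _ mu2 0%N; have [n mn kn] := hk _ mu2 m.+1.
have [Ym _ far] := hy m; have [Yn _ _] := hy n.
(* [w] is chosen so that [K (y m) - K (y n) = mu *: (y m - w)]; as [m < n], all
   three terms of [w] lie in [Y m.+1]. *)
pose w := mu^-1 *: (mu *: y n + S (y n) - S (y m)).
have Yw : Y m.+1 w.
  have Yn1 := decrn _ _ mn _ Yn; apply: subspaceZ => //; apply: subspaceB => //.
    apply: subspaceD => //; first exact: subspaceZ.
    by apply: (decrn _ _ (leqW mn)); rewrite YS; exists (y n).
  by rewrite YS; exists (y m).
have := far _ Yw; apply/negP; rewrite -ltNge -(ltr_pM2l mu_gt0) mulr1 -rnormZ.
have -> : mu *: (y m - w) = K (y m) - K (y n).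
  rewrite /w scalerBr scalerA mulfV// scale1r /spectral_shift.
  by rewrite [mu *: y n + _]addrC subrK opprB addrA [mu *: _ + _]addrC subrK.
have := rdist_triangle k (K (y m)) (K (y n)); rewrite (rdistC k); lra.
Qed.

Lemma shift_iter_inj n : (forall x, S x = 0 -> x = 0) ->
  forall x y, iter n S x = iter n S y -> x = y.
Proof.
move=> inj x y; elim: n => //= n IH /eqP; rewrite -subr_eq0 -linearB.
by move=> /eqP/inj/eqP; rewrite subr_eq0 => /eqP/IH.
Qed.

(** For injective [S], the equality [S^m H = S^(m+1) H] provided by the descent
    theorem cancels down to [H = S H]. *)
Lemma shift_fredholm : (forall x, S x = 0 -> x = 0) ->
  (forall y, exists x, S x = y) /\
  exists2 c : R, 0 < c & forall x, rnorm x <= c * rnorm (S x).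
Proof.
move=> inj; have sT : subspace [set: H] by [].
split; last first.
  have [//|c c0 hc] := shift_bounded_below sT closedT; first by move=> x _; exact: inj.
  by exists c => // x; exact: hc.
have [//|m hm] := shift_finite_descent sT closedT.
move=> y; have [|x _] := hm (iter m S y); first by exists y.
by rewrite iterSr => /(shift_iter_inj inj) <-; exists x.
Qed.

End Riesz_theory.

(** * The maximum principle *)

Section Plane.
Variable R : realType.
Implicit Types z w : R[i].

Lemma cnorm_sqr z : cnorm z ^+ 2 = complex.Re z ^+ 2 + complex.Im z ^+ 2.
Proof. by apply: complexI; rewrite add_Re2_Im2 normE_cnorm rmorphXn. Qed.

Lemma cnormD z w : cnorm (z + w) <= cnorm z + cnorm w.
Proof. by have := ler_normD z w; rewrite !normE_cnorm -rmorphD lecR. Qed.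

Lemma cnorm_le_Re_Im z : cnorm z <= `|complex.Re z| + `|complex.Im z|.
Proof.
rewrite -(@ler_pXn2r _ 2) ?nnegrE ?addr_ge0 ?cnorm_ge0// cnorm_sqr.
rewrite -[in leLHS](real_normK (num_real (complex.Re z))).
rewrite -[X in _ + X](real_normK (num_real (complex.Im z))) sqrrD.
by rewrite lerD2r lerDl mulrn_wge0// mulr_ge0.
Qed.

Lemma Re_le_cnorm z : `|complex.Re z| <= cnorm z.
Proof. by have := normc_ge_Re z; rewrite normE_cnorm lecR. Qed.

Lemma Im_le_cnorm z : `|complex.Im z| <= cnorm z.
Proof.
rewrite -(@ler_pXn2r _ 2) ?nnegrE ?cnorm_ge0// cnorm_sqr real_normK ?num_real//.
by rewrite lerDr sqr_ge0.
Qed.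

Definition plane_continuous (u : R[i] -> R) :=
  forall p (e : R), 0 < e ->
  exists2 d : R, 0 < d & forall h, cnorm h < d -> `|u (p + h) - u p| < e.

Lemma plane_continuousD u v :
  plane_continuous u -> plane_continuous v -> plane_continuous (fun z => u z + v z).
Proof.
move=> cu cv p e e0; have e20 : 0 < e / 2 by rewrite divr_gt0.
have [d1 d10 h1] := cu p _ e20; have [d2 d20 h2] := cv p _ e20.
exists (Num.min d1 d2); first by rewrite lt_min d10.
move=> h; rewrite lt_min => /andP[/h1 l1 /h2 l2].
by rewrite opprD addrACA (splitr e); apply: le_lt_trans (ler_normD _ _) (ltrD l1 l2).
Qed.

Lemma plane_continuous_sqr_cnorm (q : R) : 0 < q ->
  plane_continuous (fun z => q * cnorm z ^+ 2).
Proof.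
move=> q0 p e e0; pose m := 2 * cnorm p + 1.
have p0 := cnorm_ge0 p; have m0 : 0 < m by rewrite /m; lra.
exists (Num.min 1 (e / (q * m))); first by rewrite lt_min ltr01 divr_gt0 ?mulr_gt0.
move=> h; rewrite lt_min => /andP[h1]; rewrite ltr_pdivlMr ?mulr_gt0// => he.
have h0 := cnorm_ge0 h.
have tri : `|cnorm (p + h) - cnorm p| <= cnorm h.
  rewrite ler_norml; have := cnormD p h; have := cnormD (p + h) (- h).
  by rewrite addrK cnormN => t1 t2; apply/andP; split; lra.
rewrite -mulrBr subr_sqr normrM (gtr0_norm q0) normrM.
rewrite [X in _ * (_ * X)]ger0_norm ?addr_ge0 ?cnorm_ge0//.
apply: le_lt_trans he; rewrite mulrCA ler_pM// ?mulr_ge0 ?addr_ge0 ?cnorm_ge0 ?(ltW q0)//.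
by rewrite ler_pM2l// /m; have := cnormD p h; lra.
Qed.

(** The plane is identified with [R * R], where closed bounded sets are compact. *)
Lemma plane_max (A : set (plane R)) (u : R[i] -> R) :
  A !=set0 -> closed A -> bounded_set A -> plane_continuous u ->
  exists2 p, A p & forall z, A z -> u z <= u p.
Proof.
move=> [z0 Az0] cA /rnorm_bounded_set[M hM] cu.
have hM' z : A z -> cnorm z <= M by exact: hM.
pose phi (xy : R * R) : plane R := xy.1 +i* xy.2.
have phi_near (p : R * R) (d : R) : 0 < d ->
    \forall q \near p, cnorm (phi q - phi p) < d.
  move=> d0; apply/nbhs_ballP; exists (d / 2) => /=; first exact: divr_gt0.
  move=> q [q1 q2]; apply: le_lt_trans (cnorm_le_Re_Im _) _.
  have := q1; have := q2; rewrite /ball /= => q2' q1'.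
  rewrite (splitr d) ltrD// distrC //.
have cphi : continuous phi.
  move=> p B /(rnorm_nbhs (phi p))[e e0 hB].
  apply: filterS (phi_near p e e0) => q pq; apply: hB.
  by rewrite rdistC.
have cphiA : closed (phi @^-1` A) by apply: closed_comp => // p _; exact: cphi.
have kA : compact (phi @^-1` A).
  apply: (subclosed_compact cphiA
    (compact_setX (@segment_compact R (- M) M) (@segment_compact R (- M) M))).
  move=> [x y] /hM' h; split => /=; rewrite in_itv /= -ler_norml.
    exact: le_trans (Re_le_cnorm _) h.
  exact: le_trans (Im_le_cnorm _) h.
have surj z : phi (complex.Re z, complex.Im z) = z by case: z.
have B0 : phi @^-1` A !=set0.
  by exists (complex.Re z0, complex.Im z0); rewrite /= surj.
have [|[x y]] := compact_EVT_max (f := u \o phi) B0 kA.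
  apply: continuous_subspaceT => p; apply/cvgrPdist_lt => e e0.
  have [d d0 hd] := cu (phi p) e e0.
  apply: filterS (phi_near p d d0) => q /hd.
  by rewrite [phi p + _]addrC subrK distrC.
rewrite inE => Axy hmax; exists (phi (x, y)) => // z Az.
by have := hmax (complex.Re z, complex.Im z); rewrite inE /= surj; exact.
Qed.

End Plane.

Section Maximum_principle.
Variables (R : realType) (E : normedModType R[i]).
Implicit Types F : R[i] -> E.

(** All that the maximum principle needs of a holomorphic function. *)
Definition third_order_expansion F p := exists (a b : E) (d C : R),
  [/\ 0 < d, 0 <= C & forall h, cnorm h < d ->
      rnorm (F (p + h) - (F p + h *: a + h ^+ 2 *: b)) <= C * cnorm h ^+ 3].

Lemma third_order_continuous F : (forall p, third_order_expansion F p) ->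
  plane_continuous (fun z => rnorm (F z)).
Proof.
move=> hF p e e0; have [a [b [d [C [d0 C0 hd]]]]] := hF p.
pose B := rnorm a + rnorm b + C + 1.
have a0 := rnorm_ge0 a; have b0 := rnorm_ge0 b.
have B0 : 0 < B by rewrite /B; lra.
exists (Num.min (Num.min d 1) (e / B)).
  by rewrite !lt_min d0 ltr01 divr_gt0.
move=> h; rewrite !lt_min => /andP[/andP[hd' h1]]; rewrite ltr_pdivlMr// => hB.
have := hd _ hd'; set err := _ - _ => err_le.
have h0 := cnorm_ge0 h.
have h2 : cnorm h ^+ 2 <= cnorm h by rewrite expr2 ler_piMr// ltW.
have h3 : cnorm h ^+ 3 <= cnorm h.
  by rewrite exprS; apply: le_trans (ler_piMr h0 _) _ => //; apply: le_trans h2 (ltW h1).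
have diff : rnorm (F (p + h) - F p) < e.
  have -> : F (p + h) - F p = err + (h *: a + h ^+ 2 *: b).
    by rewrite /err -(addrA (F p)) (opprD (F p)) [_ + (- F p - _)]addrA subrK.
  apply: le_lt_trans (rnormD _ _) _.
  have := rnormD (h *: a) (h ^+ 2 *: b); rewrite !rnormZ cnormX => tri.
  have hb : cnorm h ^+ 2 * rnorm b <= cnorm h * rnorm b by rewrite ler_wpM2r.
  have hc : C * cnorm h ^+ 3 <= C * cnorm h by rewrite ler_wpM2l.
  move: hB; rewrite /B; lra.
apply: le_lt_trans diff; rewrite ler_norml lerNl opprB rnorm_distl andbT.
by rewrite rdistC rnorm_distl.
Qed.

Lemma fourth_roots_average (x y z w e1 e2 e3 e4 : E) :
  (e1 + (x + y + z) + (e2 + (x - y + z)) +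
     (e3 + (x + w - z) + (e4 + (x - w - z)))) - (e1 + e2 + (e3 + e4)) =
  x + x + (x + x).
Proof.
rewrite [e1 + _ + _]addrACA [e3 + _ + _]addrACA [e1 + e2 + _ + _]addrACA [X in X - _]addrC addrK.
rewrite [x + y + z + _]addrACA [x + w - z + _]addrACA.
rewrite [x + y + _]addrACA [x + w + _]addrACA !subrr !addr0.
by rewrite addrACA -opprD subrr addr0.
Qed.

(** Averaging over the points [p + h] with [h] in [{t, it, -t, -it}] kills the
    first and second order terms of [F], but adds [t ^+ 2] to [|z| ^+ 2]. *)
Lemma third_order_no_local_max F p (e d : R) : third_order_expansion F p ->
  0 < e -> 0 < d -> exists2 h, cnorm h < d &
    rnorm (F p) + e * cnorm p ^+ 2 < rnorm (F (p + h)) + e * cnorm (p + h) ^+ 2.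
Proof.
move=> [a [b [d' [C [d'0 C0 hF]]]]] e0 d0.
apply: contrapT => nomax.
have max h : cnorm h < d -> rnorm (F (p + h)) + e * cnorm (p + h) ^+ 2 <=
    rnorm (F p) + e * cnorm p ^+ 2.
  by move=> hd; rewrite leNgt; apply/negP => lt; apply: nomax; exists h.
have C1 : 0 < C + 1 by lra.
(* Small enough for the points to lie in both discs, and for the error [C t^3] to
   stay below the gain [e t^2]. *)
pose t := Num.min (Num.min d d') (e / (C + 1)) / 2.
have t0 : 0 < t by rewrite divr_gt0// !lt_min d0 d'0 divr_gt0.
have : t < Num.min (Num.min d d') (e / (C + 1)).
  by rewrite /t in t0 *; lra.
rewrite !lt_min => /andP[/andP[td td']]; rewrite ltr_pdivlMr// => te.
pose err h := F (p + h) - (F p + h *: a + h ^+ 2 *: b).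
have errE h : F (p + h) = err h + (F p + h *: a + h ^+ 2 *: b).
  by rewrite /err subrK.
pose T : R[i] := t%:C; pose I : R[i] := t%:C * 'i%C.
have cT : cnorm T = t by rewrite cnorm_real gtr0_norm.
have cI : cnorm I = t.
  have ci : cnorm ('i%C : R[i]) = 1.
    by apply/eqP; rewrite -(@eqrXn2 _ 2) ?cnorm_ge0// cnorm_sqr /= expr0n add0r.
  by rewrite cnormM ci mulr1 cnorm_real gtr0_norm.
have I2 : I ^+ 2 = - T ^+ 2 by rewrite exprMn sqr_i mulrN1.
have mean : 4 *: F p = (F (p + T) + F (p - T) + (F (p + I) + F (p - I)))
    - (err T + err (- T) + (err I + err (- I))).
  rewrite !errE !sqrrN I2 !scaleNr fourth_roots_average.
  by rewrite scaler_nat -[4%N]/(2 + 2)%N mulrnDr mulr2n.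
have bnd h : cnorm h = t -> rnorm (err h) <= C * t ^+ 3 /\
    rnorm (F (p + h)) <= rnorm (F p) + e * cnorm p ^+ 2 - e * cnorm (p + h) ^+ 2.
  move=> ht; split; first by rewrite -ht; apply: hF; rewrite ht.
  by have := max h; rewrite ht => /(_ td); lra.
have [e1 f1] := bnd T cT; have [e2 f2] := bnd (- T) (etrans (cnormN _) cT).
have [e3 f3] := bnd I cI; have [e4 f4] := bnd (- I) (etrans (cnormN _) cI).
have sq : cnorm (p + T) ^+ 2 + cnorm (p - T) ^+ 2 +
    (cnorm (p + I) ^+ 2 + cnorm (p - I) ^+ 2) = 4 * cnorm p ^+ 2 + 4 * t ^+ 2.
  rewrite !cnorm_sqr; case: p {hF nomax max err errE mean bnd e1 f1 e2 f2 e3 f3 e4 f4} => x y /=.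
  ring.
have norm4 : rnorm (4 *: F p) = 4 * rnorm (F p).
  by rewrite rnormZ -(rmorph_nat (real_complex R) 4) cnorm_real normr_nat.
have four (x1 x2 x3 x4 : E) : rnorm (x1 + x2 + (x3 + x4)) <=
    rnorm x1 + rnorm x2 + (rnorm x3 + rnorm x4).
  by apply: le_trans (rnormD _ _) (lerD (rnormD _ _) (rnormD _ _)).
have := rnormD (F (p + T) + F (p - T) + (F (p + I) + F (p - I)))
  (- (err T + err (- T) + (err I + err (- I)))).
rewrite -mean norm4 rnormN => tri.
have tri1 := four (F (p + T)) (F (p - T)) (F (p + I)) (F (p - I)).
have tri2 := four (err T) (err (- T)) (err I) (err (- I)).
have contra : e * t ^+ 2 <= C * t ^+ 3.
  have : e * (cnorm (p + T) ^+ 2 + cnorm (p - T) ^+ 2 +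
    (cnorm (p + I) ^+ 2 + cnorm (p - I) ^+ 2)) = e * (4 * cnorm p ^+ 2 + 4 * t ^+ 2).
    by rewrite sq.
  lra.
have t2 : 0 < t ^+ 2 by rewrite exprn_gt0.
have : C * t ^+ 3 < e * t ^+ 2.
  by rewrite exprSr mulrCA [ltRHS]mulrC ltr_pM2l//; lra.
lra.
Qed.

Lemma boundary_open (X : topologicalType) (A : set X) x :
  open A -> closure A x -> ~ A x -> boundary A x.
Proof. by move=> oA Ax nAx; split=> // /interior_subset. Qed.

(** The perturbed function [|F| + q |z|^2] attains its maximum over the closure of
    [U], and it does so on the boundary for want of local maxima; then [q] tends
    to zero. *)
Theorem maximum_principle F (U : set (plane R)) (C : R) :
  (forall p, third_order_expansion F p) -> open U -> bounded_set U ->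
  (forall z, boundary U z -> rnorm (F z) <= C) ->
  forall z, U z -> rnorm (F z) <= C.
Proof.
move=> hF oU /rnorm_bounded_set[M hM] hC z Uz.
have cM w : closure U w -> cnorm w <= M.
  move=> /rnorm_closure Uw; apply/ler_addgt0Pr => e /Uw[v Uv wv].
  have := hM _ Uv; have := rnorm_distl w v; move: wv.
  rewrite -[rnorm w]/(cnorm w); lra.
have M0 : 0 <= M := le_trans (cnorm_ge0 _) (cM _ (subset_closure Uz)).
apply/ler_addgt0Pr => e e0.
have M1 : 0 < M ^+ 2 + 1 by rewrite ltr_wpDl// sqr_ge0.
pose q := e / (M ^+ 2 + 1); have q0 : 0 < q by rewrite divr_gt0.
have qM : q * M ^+ 2 <= e.
  by rewrite /q mulrAC ler_pdivrMr// ler_pM2l// lerDl.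
pose u w := rnorm (F w) + q * cnorm w ^+ 2.
have cu : plane_continuous u.
  apply: plane_continuousD; first exact: third_order_continuous.
  exact: plane_continuous_sqr_cnorm.
have [||||p Up pmax] := @plane_max R (closure U) u.
- by exists z; exact: subset_closure.
- exact: closed_closure.
- by apply/rnorm_bounded_set; exists M.
- exact: cu.
have uz : u z <= u p by apply: pmax; exact: subset_closure.
have cz := cnorm_ge0 z.
have pU : ~ U p.
  move=> Up'; have /rnorm_nbhs[d d0 hd] := open_nbhs_nbhs (conj oU Up').
  have [h hd' /lt_geF] := third_order_no_local_max (hF p) q0 d0.
  rewrite pmax//; apply: subset_closure; apply: hd.
  by rewrite opprD addrA subrr sub0r rnormN.
have := hC p (boundary_open oU Up pU); move: uz; rewrite /u.
have : q * cnorm p ^+ 2 <= q * M ^+ 2.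
  by rewrite ler_pM2l// ler_pXn2r ?nnegrE ?cnorm_ge0// cM.
have : 0 <= q * cnorm z ^+ 2 by rewrite mulr_ge0 ?(ltW q0)// sqr_ge0.
lra.
Qed.

End Maximum_principle.

(** * Closures of spans *)

Section Closed_span.
Variables (R : realType) (H : normedModType R[i]).
Implicit Types (V B : set H).

Lemma linear_span_subspace B : subspace (linear_span B).
Proof.
split=> [|c _ _ [n [a [x [Bx ->]]]] [m [b [y [By ->]]]]].
  by exists 0%N, (fun=> 0), (fun=> 0); split=> [[]//|]; rewrite big_ord0.
exists (n + m)%N.
exists (fun i => match fintype.split i with inl j => c * a j | inr j => b j end).
exists (fun i => match fintype.split i with inl j => x j | inr j => y j end).
split=> [i|]; first by case: (fintype.split i).
rewrite big_split_ord /= scaler_sumr; congr (_ + _); apply: eq_bigr => i _.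
  by rewrite (unsplitK (inl i)) scalerA.
by rewrite (unsplitK (inr i)).
Qed.

Lemma sub_linear_span B : B `<=` linear_span B.
Proof.
move=> x Bx; exists 1%N, (fun=> 1), (fun=> x); split=> //.
by rewrite big_ord1 scale1r.
Qed.

Lemma linear_span_invariant B (S : {linear H -> H}) :
  (forall x, B x -> B (S x)) -> forall x, linear_span B x -> linear_span B (S x).
Proof.
move=> SB _ [n [a [x [Bx ->]]]]; exists n, a, (S \o x); split=> [i|].
  exact: SB.
by rewrite linear_sum; apply: eq_bigr => i _; rewrite linearZ.
Qed.

Lemma closure_subspace V : subspace V -> subspace (closure V).
Proof.
move=> sV; split=> [|c x y /rnorm_closure Vx /rnorm_closure Vy].
  by apply: subset_closure; exact: subspace0.
apply/rnorm_closure => e e0; have e20 : 0 < e / 2 by rewrite divr_gt0.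
have c1 : 0 < cnorm c + 1 by rewrite ltr_wpDl// cnorm_ge0.
have [|x' Vx' xx'] := Vx (e / 2 / (cnorm c + 1)); first by rewrite divr_gt0.
have [y' Vy' yy'] := Vy _ e20.
exists (c *: x' + y'); first by case: sV => _; exact.
rewrite opprD addrACA -scalerBr; apply: le_lt_trans (rnormD _ _) _.
rewrite rnormZ; have := rnorm_ge0 (x - x').
move: xx'; rewrite ltr_pdivlMr//; lra.
Qed.

Lemma closure_invariant V (S : {linear H -> H}) : rbounded S ->
  (forall x, V x -> V (S x)) -> forall x, closure V x -> closure V (S x).
Proof.
move=> bS SV x /rnorm_closure Vx; apply/rnorm_closure => e /(rbounded_small bS)[d d0 hd].
have [y Vy xy] := Vx _ d0; exists (S y); first exact: SV.
by rewrite -linearB; exact: hd.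
Qed.

End Closed_span.

(** * Root vectors of an operator and of its resolvent *)

Section Resolvents.
Variables (R : realType) (H : normedModType R[i]) (T : operator H).

Lemma op_fun0 : T 0 = 0.
Proof.
have := op_fun_linear (1 : R[i]) (op_dom0 T) (op_dom0 T).
rewrite scaler0 addr0 scale1r => /eqP.
by rewrite -[X in X == _]addr0 (inj_eq (addrI _)) eq_sym => /eqP.
Qed.

Lemma op_domD x y : op_dom T x -> op_dom T y -> op_dom T (x + y).
Proof. by move=> Dx Dy; have := op_dom_linear (1 : R[i]) Dx Dy; rewrite scale1r. Qed.

Lemma op_domZ a x : op_dom T x -> op_dom T (a *: x).
Proof. by move=> Dx; have := op_dom_linear a Dx (op_dom0 T); rewrite addr0. Qed.

Definition inverse_of_shift (z : R[i]) (A : {linear H -> H}) :=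
  [/\ forall y, op_dom T (A y), forall y, op_shift T z (A y) = y &
      forall x, op_dom T x -> A (op_shift T z x) = x].

Lemma resolvent_inverse (z : plane R) : resolvent_set T z ->
  exists2 A : {linear H -> H}, (A : H -> H) = resolvent T z & inverse_of_shift z A.
Proof.
move=> [bij _]; pose A := resolvent T z.
have [_ injT surjT] := bij.
have AD y : op_dom T (A y).
  by have [h _ _] := bijpinv_bij (fun=> 0) bij; apply: h.
have TA y : op_shift T z (A y) = y.
  by apply: (surjpK (fun=> 0) surjT); rewrite inE.
have AT x : op_dom T x -> A (op_shift T z x) = x.
  by move=> Dx; apply: (pinvKV (fun=> 0) injT); rewrite inE.
have A_linear : linear A.
  move=> a x y; rewrite -[RHS]AT; last by apply: op_dom_linear.
  rewrite /op_shift op_fun_linear// scalerDr scalerA mulrC -scalerA opprD.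
  by rewrite addrACA -scalerBr -!/(op_shift _ _ _) !TA.
by have [B BA] := bundle_linear A_linear; exists B; rewrite /inverse_of_shift BA.
Qed.

Lemma operator_norm_bound (A : {linear H -> H}) (C : R) :
  rbounded A -> operator_norm A <= C -> forall y, rnorm (A y) <= C * rnorm y.
Proof.
move=> [M M0 hM] AC y; have [->|y0] := eqVneq y 0.
  by rewrite linear0 !rnorm0 mulr0.
have ry : 0 < rnorm y by rewrite rnorm_gt0.
rewrite -ler_pdivrMr// mulrC; apply: le_trans AC.
pose a := (rnorm y)^-1%:C.
have aE : cnorm a = (rnorm y)^-1 by rewrite cnorm_real ger0_norm// invr_ge0 ltW.
rewrite -aE -rnormZ -linearZ; apply: ub_le_sup.
  exists M => _ [x /= x1 <-]; apply: le_trans (hM x) _.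
  rewrite -[leRHS]mulr1 ler_wpM2l//; move: x1.
  by rewrite normE_rnorm -(rmorph1 (real_complex R)) lecR.
exists (a *: y) => //=.
by rewrite normE_rnorm rnormZ aE mulVf ?gt_eqF.
Qed.

Variables (z0 : R[i]) (A : {linear H -> H}).
Hypothesis invA : inverse_of_shift z0 A.

Lemma inverse_dom y : op_dom T (A y). Proof. by case: invA. Qed.

Lemma inverseK x : op_dom T x -> A (op_shift T z0 x) = x.
Proof. by case: invA => _ _; exact. Qed.

Lemma shift_inverse y : op_shift T z0 (A y) = y. Proof. by case: invA. Qed.

Lemma op_shift_change z x :
  op_shift T z x = op_shift T z0 x + (z0 - z) *: x.
Proof. by rewrite /op_shift scalerBl addrA subrK. Qed.

Lemma inverse_inj x : A x = 0 -> x = 0.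
Proof.
by move=> Ax; rewrite -(shift_inverse x) Ax /op_shift op_fun0 scaler0 subr0.
Qed.

Lemma inverse_shiftC z x : op_dom T x -> op_shift T z (A x) = A (op_shift T z x).
Proof.
move=> Dx; rewrite (op_shift_change z (A x)) (op_shift_change z x) shift_inverse linearD linearZ /=.
by rewrite inverseK.
Qed.

Lemma root_subspace_invariant z x :
  root_subspace T z x -> root_subspace T z (A x).
Proof.
move=> [k _ [Dx kx]]; exists k => //.
have E i : (i <= k)%N -> iter i (op_shift T z) (A x) = A (iter i (op_shift T z) x).
  by elim: i => //= i IH ik; rewrite IH ?inverse_shiftC//; [exact: Dx|exact: ltnW].
by split=> [i ik|]; rewrite E ?(ltnW ik)//; [exact: inverse_dom|rewrite kx linear0].
Qed.

Variable mu : R[i].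
Hypothesis mu0 : mu != 0.

Local Notation S := (spectral_shift A mu).
Local Notation lam := (z0 + mu^-1).

Lemma inverse_iterC n x : A (iter n S x) = iter n S (A x).
Proof.
by elim: n => //= n <-; rewrite /spectral_shift linearB linearZ.
Qed.

(** [mu *: x] differs from a vector of the range of [A] by [- S x], which is in the
    domain by induction. *)
Lemma ker_shift_dom n x : iter n S x = 0 -> op_dom T x.
Proof.
elim: n x => [x /= ->|n IH x]; first exact: op_dom0.
rewrite iterSr => /IH DSx.
rewrite -[x]scale1r -(mulVf mu0) -scalerA; apply: op_domZ.
have -> : mu *: x = -1 *: S x + A x by rewrite scaleN1r /spectral_shift opprB subrK.
by apply: op_domD; [exact: op_domZ|exact: inverse_dom].
Qed.

Lemma op_shift_spectral x : op_dom T x ->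
  op_shift T lam x = - mu^-1 *: S (op_shift T z0 x).
Proof.
move=> Dx; rewrite (op_shift_change lam x) opprD addrA subrr sub0r.
rewrite /spectral_shift inverseK// scalerBr scalerA mulNr mulVf// scaleN1r opprK.
by rewrite addrC.
Qed.

(** By [op_shift_spectral] and injectivity of [A], a vector killed by [S^(n+1)] is
    sent by [T - lam] to one killed by [S^n]. *)
Lemma ker_shift_root n x : iter n S x = 0 -> ker_power T lam n x.
Proof.
elim: n x => [//|n IH x Sx].
have Dx := ker_shift_dom Sx.
have [] := IH (op_shift T lam x).
  apply: inverse_inj; rewrite inverse_iterC -inverse_shiftC//.
  rewrite op_shift_spectral; last exact: inverse_dom.
  rewrite shift_inverse -[_ *: S x]addr0 shift_iter_linear -iterSr Sx.
  by rewrite scaler0 add0r; elim: (n) => //= m ->; rewrite linear0.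
move=> D0 S0; split=> [[|i] //|]; last by rewrite iterSr.
by rewrite iterSr; exact: D0.
Qed.

Lemma ker_shift_eigenvalue n x : iter n S x = 0 -> x != 0 -> eigenvalue_of T lam.
Proof.
elim: n x => [x /= ->|n IH x]; first by rewrite eqxx.
rewrite iterSr => Snx x0; have [Sx|] := eqVneq (S x) 0; last exact: IH.
have Dx : op_dom T x := @ker_shift_dom 1 x Sx.
exists x; split=> //; apply/eqP; rewrite -subr_eq0.
by have [_ /= /eqP] := @ker_shift_root 1 x Sx.
Qed.

End Resolvents.

(** * The solutions of v - w K v = c as a function of w *)

Section Entire_family.
Variables (R : realType) (H : normedModType R[i]) (K : {linear H -> H}).
Hypothesis bK : rbounded K.
Hypothesis solvable : forall (w : R[i]) c, exists v, v - w *: K v = c.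
Hypothesis stable : forall w : R[i], exists2 l : R, 0 < l &
  forall v, rnorm v <= l * rnorm (v - w *: K v).

Lemma solution_unique w v v' : v - w *: K v = v' - w *: K v' -> v = v'.
Proof.
move=> E; have [l l0 hl] := stable w; apply/eqP; rewrite -subr_eq0 -rnorm_eq0.
rewrite eq_le rnorm_ge0 andbT; apply: le_trans (hl _) _.
have -> : v - v' - w *: K (v - v') = v - w *: K v - (v' - w *: K v').
  by rewrite linearB scalerBr !opprB [w *: _ - _]addrC addrACA [- v' + _]addrC.
by rewrite E subrr rnorm0 mulr0.
Qed.

(** Each remainder of the expansion solves an equation whose right-hand side is
    [h] times [K] of the preceding remainder, and so gains a factor [h]; this is
    the resolvent identity, iterated three times. *)
Lemma solution_third_order (F : R[i] -> H) c :
  (forall w, F w - w *: K (F w) = c) -> forall p, third_order_expansion F p.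
Proof.
move=> hF p; have [l l0 hl] := stable p; have [M M0 hM] := bK.
have [a ha] := solvable p (K (F p)); have [b hb] := solvable p (K a).
have step h x y : x - p *: K x = h *: K y -> rnorm x <= l * M * cnorm h * rnorm y.
  move=> E; apply: le_trans (hl x) _; rewrite E rnormZ -!mulrA ler_pM2l//.
  by rewrite mulrCA ler_wpM2l ?cnorm_ge0.
pose q := l * M; have q0 : 0 <= q by rewrite mulr_ge0// ltW.
have q1 : 0 < 2 * (q + 1) by lra.
(* The radius ensures [q * |h| <= 1 / 2], hence [|F (p + h)| <= 2 |F p|], which
   makes the last remainder explicit. *)
exists a, b, (2 * (q + 1))^-1, (2 * q ^+ 3 * rnorm (F p)); split.
- by rewrite invr_gt0.
- by apply: mulr_ge0 (rnorm_ge0 _); apply: mulr_ge0 => //; exact: exprn_ge0.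
move=> h hd; have h0 := cnorm_ge0 h.
have qh : q * cnorm h <= 1 / 2.
  by move: hd; rewrite -[X in _ < X]div1r ltr_pdivlMr//; lra.
have qh0 : 0 <= q * cnorm h by rewrite mulr_ge0.
pose E x := x - p *: K x.
have ED x y : E (x - y) = E x - E y.
  by rewrite /E linearB scalerBr !opprB [p *: _ - _]addrC addrACA [- y + _]addrC.
have EZ k x : E (k *: x) = k *: E x.
  by rewrite /E [K (k *: x)]linearZ /= scalerBr !scalerA mulrC.
pose e1 := F (p + h) - F p; pose e2 := e1 - h *: a.
pose e3 := F (p + h) - (F p + h *: a + h ^+ 2 *: b).
have E1 : E e1 = h *: K (F (p + h)).
  rewrite ED; apply/eqP; rewrite subr_eq; apply/eqP.
  by rewrite [E (F p)]hF -(hF (p + h)) scalerDl opprD addrCA [h *: _ + _]addrC subrK.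
have E2 : E e2 = h *: K e1 by rewrite ED EZ E1 [E a]ha linearB scalerBr.
have e3E : e3 = e2 - h ^+ 2 *: b by rewrite /e3 !opprD !addrA.
have E3 : E e3 = h *: K e2.
  by rewrite e3E ED EZ E2 [E b]hb /e2 [K (e1 - _)]linearB [K (h *: a)]linearZ /= scalerBr scalerA.
have s1 := step _ _ _ E1; have s2 := step _ _ _ E2; have s3 := step _ _ _ E3.
rewrite -/q in s1 s2 s3.
have Fph : rnorm (F (p + h)) <= 2 * rnorm (F p).
  have : rnorm (F (p + h)) - rnorm (F p) <= rnorm e1 := rnorm_distl _ _.
  have : q * cnorm h * rnorm (F (p + h)) <= 1 / 2 * rnorm (F (p + h)).
    by rewrite ler_wpM2r ?rnorm_ge0.
  lra.
rewrite -/e3; apply: le_trans s3 _.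
have -> : 2 * q ^+ 3 * rnorm (F p) * cnorm h ^+ 3 =
    q * cnorm h * (q * cnorm h * (q * cnorm h * (2 * rnorm (F p)))) by ring.
apply: ler_wpM2l => //; apply: le_trans s2 _.
apply: ler_wpM2l => //; apply: le_trans s1 _.
exact: ler_wpM2l.
Qed.

End Entire_family.

(** * The closed span of the root subspaces *)

Section Root_closure.
Variables (R : realType) (H : normedModType R[i]).
Hypothesis complete : cauchy_sequences_converge H.
Hypothesis splits : closed_subspaces_split H.
Variables (T : operator H) (z0 : R[i]) (A : {linear H -> H}).
Hypotheses (invA : inverse_of_shift T z0 A) (bA : rbounded A).
Hypothesis cA : seq_compact_operator A.

Definition root_closure : set H :=
  closure (linear_span (\bigcup_(z in eigenvalue_of T) root_subspace T z)).

Lemma root_closure_subspace : subspace root_closure.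
Proof. by apply: closure_subspace; exact: linear_span_subspace. Qed.

Lemma root_closure_closed : closed root_closure.
Proof. exact: closed_closure. Qed.

Lemma root_closure_invariant x : root_closure x -> root_closure (A x).
Proof.
apply: closure_invariant => // {}x; apply: linear_span_invariant => {}x.
by move=> [z ez rx]; exists z => //; exact: (root_subspace_invariant invA).
Qed.

Lemma ker_shift_root_closure mu n x : mu != 0 ->
  iter n (spectral_shift A mu) x = 0 -> root_closure x.
Proof.
move=> mu0 Sx; have [->|x0] := eqVneq x 0; first exact: subspace0 root_closure_subspace.
apply: subset_closure; apply: sub_linear_span; exists (z0 + mu^-1).
  exact: (ker_shift_eigenvalue invA mu0 Sx).
by exists n => //; exact: (ker_shift_root invA mu0 Sx).
Qed.

(** Descent inside the invariant subspace [M = root_closure]: with [S = A - mu],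
    the vector [S^(m+1) x = S^m (S x)] lies in [S^m M], so it is [S^(m+1) y] for
    some [y] in [M], and [x - y] is a root vector. *)
Lemma shift_root_closure mu x : mu != 0 ->
  root_closure (spectral_shift A mu x) -> root_closure x.
Proof.
move=> mu0 Sx; have sM := root_closure_subspace.
have [|m hm] := shift_finite_descent complete splits cA bA mu0 sM root_closure_closed.
  by move=> y My; apply: (subspaceB sM); [exact: root_closure_invariant|exact: (subspaceZ sM)].
have [|y My Sy] := hm (iter m.+1 (spectral_shift A mu) x).
  by exists (spectral_shift A mu x) => //; rewrite -iterSr.
rewrite -[x](subrK y); apply: (subspaceD sM) => //.
apply: (@ker_shift_root_closure mu m.+1) => //.
by rewrite -scaleN1r addrC shift_iter_linear Sy scaleN1r addNr.
Qed.

Variable P : {linear H -> H}.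
Hypotheses (P1 : forall x, rnorm (P x) <= rnorm x)
  (P0 : forall x, root_closure x <-> P x = 0)
  (PM : forall x, root_closure (x - P x)).

Definition compression : {linear H -> H} := P \o A.

Lemma compression_rbounded : rbounded compression.
Proof.
have bP : rbounded P by exists 1 => // x; rewrite mul1r.
exact: (rbounded_comp bP bA).
Qed.

Lemma compression_compact : seq_compact_operator compression.
Proof.
move=> u /cA[k hk]; exists (P k) => e e0 N; have [n Nn kn] := hk e e0 N.
by exists n => //=; rewrite -linearB; exact: le_lt_trans (P1 _) kn.
Qed.

Lemma projK x : P (P x) = P x.
Proof. by have /P0/eqP := @PM x; rewrite linearB subr_eq0 => /eqP. Qed.

(** [A] maps [x - P x] into [root_closure], the kernel of [P]. *)
Lemma compression_proj x : P (A x) = compression (P x).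
Proof.
apply/eqP; rewrite -subr_eq0 /= -!linearB /=; apply/eqP/P0.
exact: root_closure_invariant.
Qed.

(** An eigenvector [x] of [P A] for [mu != 0] lies in the range of [P], and
    [(A - mu) x] lies in [root_closure]; hence so does [x], and [x = P x = 0]. *)
Lemma compression_no_eigenvalue mu x : mu != 0 ->
  spectral_shift compression mu x = 0 -> x = 0.
Proof.
move=> mu0 /eqP; rewrite subr_eq0 => /eqP Kx.
have Px : P x = x.
  by apply: (scalerI mu0); rewrite -linearZ -Kx /= projK.
have /P0 : root_closure x; last by rewrite Px.
apply: (@shift_root_closure mu) => //; apply/P0.
by rewrite /spectral_shift linearB linearZ /= Px -[P (A x)]/(compression x) Kx subrr.
Qed.

(** For [w != 0] the operator [1 - w K] is a multiple of the shift of the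
    compression [K] by [w^-1]. *)
Lemma compression_fredholm (w : R[i]) :
  (forall c, exists v, v - w *: compression v = c) /\
  exists2 l : R, 0 < l & forall v, rnorm v <= l * rnorm (v - w *: compression v).
Proof.
have [->|w0] := eqVneq w 0.
  split=> [c|]; first by exists c; rewrite scale0r subr0.
  by exists 1 => // v; rewrite scale0r subr0 mul1r.
have mu0 : w^-1 != 0 by rewrite invr_eq0.
have E v : v - w *: compression v = - w *: spectral_shift compression w^-1 v.
  by rewrite /spectral_shift scalerBr scalerA mulNr mulfV// scaleN1r opprK addrC scaleNr.
have [surj [l l0 hl]] := shift_fredholm complete splits compression_compact
  compression_rbounded mu0 (fun x => @compression_no_eigenvalue _ x mu0).
split=> [c|].
  have [v Sv] := surj (- w^-1 *: c); exists v.
  by rewrite E Sv scalerA mulrNN mulfV// scale1r.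
have cw : 0 < cnorm w by rewrite cnorm_gt0.
exists (l / cnorm w); first by rewrite divr_gt0.
by move=> v; rewrite E rnormZ cnormN mulrA divfK ?gt_eqF.
Qed.

(** The equation satisfied by [P (T - z)^-1 y] involves only the compression of
    [A]; by [compression_fredholm] it can be solved for every [z]. *)
Lemma proj_resolvent z (B : {linear H -> H}) y : inverse_of_shift T z B ->
  P (B y) - (z - z0) *: compression (P (B y)) = compression (P y).
Proof.
move=> invB; rewrite -!compression_proj.
have BE : B y = A y + (z - z0) *: A (B y).
  rewrite -{1}(inverseK invA (inverse_dom invB y)) (op_shift_change T z z0).
  by rewrite (shift_inverse invB) linearD linearZ.
by rewrite {1}BE linearD linearZ /= addrK.
Qed.

End Root_closure.

(** * Completeness *)

Section Liouville.
Variables (R : realType) (E : normedModType R[i]).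

Lemma third_order_expansion_shift (F : R[i] -> E) z0 p :
  third_order_expansion F (p - z0) -> third_order_expansion (fun z => F (z - z0)) p.
Proof.
move=> [a [b [d [C [d0 C0 h]]]]]; exists a, b, d, C; split=> // t td.
by rewrite addrAC; exact: h.
Qed.

Lemma ball_bounded (r : R) : bounded_set ([set z | cnorm z < r] : set (plane R)).
Proof. by apply/rnorm_bounded_set; exists r => z /= /ltW. Qed.

Lemma ball_open_cnorm (r : R) : open ([set z | cnorm z < r] : set (plane R)).
Proof.
rewrite openE => z /= zr; apply/rnorm_nbhs.
exists (r - cnorm z); first by rewrite subr_gt0.
move=> w zw /=; have : cnorm w - cnorm z <= rnorm (w - z) := @rnorm_distl _ (plane R) w z.
rewrite rdistC; lra.
Qed.

(** On a disc of radius [r] the maximum principle bounds [G] by [B / r]. *)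
Lemma decay_vanish (G : R[i] -> E) (B : R) :
  (forall p, third_order_expansion G p) ->
  (forall w, cnorm w * rnorm (G w) <= B) -> G 0 = 0.
Proof.
move=> hG hB; apply: rnorm_small => e e0.
have B0 : 0 <= B by apply: le_trans (hB 0); rewrite mulr_ge0 ?cnorm_ge0 ?rnorm_ge0.
pose r := 2 * (B + 1) / e; have r0 : 0 < r by rewrite divr_gt0 ?mulr_gt0//; lra.
have : rnorm (G 0) <= e / 2.
  apply: (@maximum_principle _ _ G ([set z | cnorm z < r] : set (plane R))) => //.
  - exact: ball_open_cnorm.
  - exact: ball_bounded.
  - move=> z [_]; rewrite (interior_id _).1; last exact: ball_open_cnorm.
    move=> /negP; rewrite -leNgt => rz.
    have : r * rnorm (G z) <= B by apply: le_trans (hB z); rewrite ler_wpM2r ?rnorm_ge0.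
    rewrite -ler_pdivlMl// => /le_trans; apply.
    by rewrite /r invf_div mulrAC ler_pdivrMr ?mulr_gt0//; nra.
  - by rewrite /= /cnorm normr0.
lra.
Qed.

End Liouville.

Lemma root_closure_full (R : realType) (H : normedModType R[i])
    (complete : cauchy_sequences_converge H) (splits : closed_subspaces_split H)
    (T : operator H) (Tdense : densely_defined T)
    (Tcompact : has_compact_resolvent T)
    (U : nat -> set (plane R))
    (Uopen : forall k, open (U k))
    (Ubounded : forall k, bounded_set (U k))
    (Ucover : \bigcup_k U k = [set: plane R])
    (Uboundary : forall k, boundary (U k) `<=` resolvent_set T) (C : R)
    (Uresolvent : forall k z, boundary (U k) z -> operator_norm (resolvent T z) <= C)
    (x : H) :
  root_closure T x.
Proof.
have [z0 rz0 cpt] := Tcompact.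
have [A AE invA] := resolvent_inverse rz0.
have bA : rbounded A by rewrite AE; apply: bounded_operator_rbounded; case: rz0.
have cA : seq_compact_operator A by rewrite AE; exact: compact_operator_seq.
have [P [P1 P0 PM]] := splits _ (root_closure_subspace T) (root_closure_closed (T := T)).
pose K := compression A P.
have bK : rbounded K := compression_rbounded bA P1.
have fred w := compression_fredholm complete splits invA bA cA P1 P0 PM w.
have solvable w c := (fred w).1 c; have stable w := (fred w).2.
have family c : exists F : R[i] -> H, forall w, F w - w *: K (F w) = c.
  by have /choice[F hF] := fun w => solvable w c; exists F.
(* [f] extends [P (T - z)^-1 y], and [g] is its difference quotient at [0]. *)
have AAM y : root_closure T (A (A y)).
  have [f hf] := family (K (P y)); have [g hg] := family (K (K (P y))).
  have gf w : w *: g w = f w - K (P y).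
    have -> : g w = K (f w).
      apply: (solution_unique stable (w := w)).
      by rewrite hg -linearZ -linearB hf.
    by rewrite -(hf w) opprB addrC subrK.
  have fbound w : rnorm (f w) <= C * rnorm y.
    pose F (z : R[i]) := f (z - z0).
    have [k _ Uw] : (\bigcup_k U k) (w + z0) by rewrite Ucover.
    suff : rnorm (F (w + z0)) <= C * rnorm y by rewrite /F addrK.
    apply: (maximum_principle _ (Uopen k) (Ubounded k) _ Uw) => [p|z Uz].
      by apply: third_order_expansion_shift; exact: solution_third_order hf _.
    have rz := Uboundary k z Uz; have [B BE invB] := resolvent_inverse rz.
    have -> : F z = P (B y).
      apply: (solution_unique stable (w := z - z0)).
      by rewrite hf (proj_resolvent invA bA P0 PM _ invB).
    apply: le_trans (P1 _) _; apply: operator_norm_bound.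
      by rewrite BE; apply: bounded_operator_rbounded; case: rz.
    by rewrite BE; exact: (Uresolvent k z Uz).
  have : g 0 = 0.
    apply: (@decay_vanish _ _ _ (C * rnorm y + rnorm (K (P y)))).
      exact: solution_third_order hg.
    move=> w; rewrite -rnormZ gf; apply: le_trans (rnormD _ _) _.
    by rewrite rnormN lerD2r.
  move=> g0; apply/P0; have := hg 0; rewrite g0 linear0 scaler0 subr0 => KK.
  by rewrite !(compression_proj invA bA P0 PM).
apply: (rnorm_closed (root_closure_closed (T := T))) => e e0.
(* The range of [A] is the domain of [T], hence dense; by continuity so is the
   range of [A \o A]. *)
have range v (d : R) : 0 < d -> exists y, rnorm (v - A y) < d.
  move=> d0; have /rnorm_closure/(_ d d0)[u Du vu] := (rnorm_dense _).1 Tdense v.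
  by exists (op_shift T z0 u); rewrite (inverseK invA Du).
have e20 : 0 < e / 2 by rewrite divr_gt0.
have [d d0 hd] := rbounded_small bA e20.
have [y xy] := range x _ e20; have [y' yy'] := range y _ d0.
exists (A (A y')); first exact: AAM.
have := rdist_triangle (A y) x (A (A y')).
by have := hd _ yy'; rewrite linearB; lra.
Qed.

Theorem theorem2p3 (R : realType) (H : completeNormedModType R[i])
    (dot : {dot H for Num.conj}) (Hhilbert : hilbert_inner_product dot)
    (T : operator H) (Tdense : densely_defined T)
    (Tcompact : has_compact_resolvent T)
    (U : nat -> set (plane R))
    (Uregion : forall k, region (U k))
    (Ubounded : forall k, bounded_set (U k))
    (Ucover : \bigcup_k U k = [set: plane R])
    (Uboundary : forall k, boundary (U k) `<=` resolvent_set T)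
    (Uresolvent : exists2 C : R, 0 <= C &
       forall k z, boundary (U k) z -> operator_norm (resolvent T z) <= C) :
  root_subspaces_complete T.
Proof.
have [C C0 hC] := Uresolvent.
have complete : cauchy_sequences_converge H := @complete_cauchy_sequences R H.
have splits : closed_subspaces_split H.
  exact: (@orthogonal_projection R H dot Hhilbert complete).
apply/rnorm_dense => x.
apply: (root_closure_full complete splits Tdense Tcompact _ Ubounded Ucover Uboundary hC).
by move=> k; have [] := Uregion k.
Qed.
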